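(* Let $W$ be the Weyl group of type $B_{n+1}$ with $S=\{0,1,\dots,n\}$, and let $0\leq j\leq n$. Then the set ${}_0\mathbf{JI}_j$ consists of the elements $$b_k=b^{0j}_k:=s_{00}\cdot s_{10}\cdots s_{k-1,0}\cdot s_{k,1}\cdot s_{k+1,2}\cdots s_{k+j-1,j},\qquad 1\leq k\leq n+1-j.$$ As a signed permutation, $b_k$ is given by $b_k(m)=k+m$ for $1\leq m\leq j$, $b_k(j+m)=-(k+1-m)$ for $1\leq m\leq k$, and $b_k(m)=m$ for $j+k<m\leq n+1$. There is no cancellation in the product $s_{00}\cdot s_{10}\cdots s_{k-1,0}\cdot s_{k,1}\cdot s_{k+1,2}\cdots s_{k+j-1,j}$, i.e. concatenating the reduced expressions of the factors gives a reduced expression for $b_k$. Moreover, as a subposet of $(W,\leq)$, ${}_0\mathbf{JI}_j$ is a chain $$b_1<b_2<\cdots<b_{n+1-j}.$$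
   Context: Type $B_{n+1}$, $n\geq1$: the simple reflections are labeled $0,1,\dots,n$ along the Coxeter diagram, a path $0-1-\cdots-n$ whose only multiple (double) edge joins $0$ and $1$. $s_{ij}$ denotes the product $i\cdots j$ of simple reflections along the unique shortest path from $i$ to $j$ in the diagram (e.g. $s_{00}=0$, $s_{20}=210$). $W$ is identified with signed permutations of $\{\pm1,\dots,\pm(n+1)\}$ (bijections $w$ with $w(-m)=-w(m)$): the simple reflection $0$ sends $1\mapsto-1$ and fixes $2,\dots,n+1$, and for $m\geq1$ the simple reflection $m$ swaps $m$ and $m+1$; products are composed as functions, the rightmost factor acting first. $\leq$ is the Bruhat order. An element $w\in W$ is join-irreducible if there is no $U\subseteq W$ with $w=\bigvee U$ (supremum in $(W,\leq)$, $\bigvee\varnothing=e$) and $w\notin U$. Every join-irreducible element has exactly one left descent and one right descent; ${}_i\mathbf{JI}_j$ is the set of join-irreducible elements whose left descent is $i$ and right descent is $j$, with the order induced from the Bruhat order. *)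

(* Defs.v *)
From HB Require Import structures.
From mathcomp Require Import all_boot all_order all_algebra all_fingroup.
From mathcomp Require Import zify.

Set Implicit Arguments.
Unset Strict Implicit.
Unset Printing Implicit Defensive.

Import Order.TTheory GRing.Theory Num.Theory GroupScope.

Record spoint (n : nat) := SPoint {
  spoint_val :> int;
  _ : 0 < `|spoint_val|%N <= n.+1
}.

HB.instance Definition _ n := [isSub for @spoint_val n].
HB.instance Definition _ n := [Countable of spoint n by <:].

Section SPoint.
Variable n : nat.
Implicit Types x y : spoint n.

Definition spoint_enum : seq (spoint n) :=
  pmap insub ([seq Posz m.+1 | m <- iota 0 n.+1] ++
              [seq Negz m | m <- iota 0 n.+1]).

Lemma spoint_enumP : Finite.axiom spoint_enum.
Proof.
apply: Finite.uniq_enumP => [|x].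
  apply: pmap_sub_uniq.
  rewrite cat_uniq !map_inj_uniq ?iota_uniq ?andbT; try by move=> a b [].
  by apply/hasPn => _ /mapP[i _ ->]; apply/mapP => -[].
rewrite mem_pmap_sub mem_cat; apply/orP.
case: x => -[[//|m]|m] hm; [left|right]; apply/mapP; exists m => //.
all: by rewrite mem_iota add0n.
Qed.

HB.instance Definition _ := isFinite.Build (spoint n) spoint_enumP.

(* The point with value [z]; a junk point when [z] is not in
   {±1, ..., ±(n+1)}. *)
Definition pt (z : int) : spoint n :=
  insubd (@SPoint n (Posz 1) (ltn0Sn n)) z.

Lemma val_pt z : 0 < `|z|%N <= n.+1 -> spoint_val (pt z) = z.
Proof. by move=> hz; rewrite /pt val_insubd hz. Qed.

Fact sneg_subproof x : 0 < `|(- spoint_val x)%R|%N <= n.+1.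
Proof. by rewrite abszN; case: x. Qed.

Definition sneg x : spoint n := SPoint (sneg_subproof x).

Lemma snegK : involutive sneg.
Proof. by move=> x; apply: val_inj; rewrite /= opprK. Qed.

Lemma sneg_pt z : 0 < `|z|%N <= n.+1 -> sneg (pt z) = pt (- z)%R.
Proof. by move=> hz; apply: val_inj; rewrite /= !val_pt ?abszN. Qed.

End SPoint.

Record sperm (n : nat) := SPerm {
  sperm_val :> {perm spoint n};
  _ : [forall x, sperm_val (sneg x) == sneg (sperm_val x)]
}.

HB.instance Definition _ n := [isSub for @sperm_val n].
HB.instance Definition _ n := [Finite of sperm n by <:].

Section SPerm.
Variable n : nat.
Implicit Types (u v w : sperm n) (x : spoint n).

Lemma spermN w x : w (sneg x) = sneg (w x).
Proof. by case: w => p /= /forallP/(_ x)/eqP. Qed.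

Lemma spermP u v : u =1 v -> u = v.
Proof. by move=> uv; apply/val_inj/permP. Qed.

Fact sperm_one_subproof :
  [forall x : spoint n, (1 : {perm _}) (sneg x) == sneg ((1 : {perm _}) x)].
Proof. by apply/forallP => x; rewrite !perm1. Qed.

Definition sperm_one : sperm n := SPerm sperm_one_subproof.

Fact sperm_mul_subproof u v : [forall x,
  (sperm_val v * sperm_val u) (sneg x) ==
  sneg ((sperm_val v * sperm_val u) x)].
Proof. by apply/forallP => x; rewrite !permM !spermN. Qed.

(* The product of [{perm _}] applies its left factor first, hence the swap:
   [u * v] in [sperm n] is the composite [u \o v]. *)
Definition sperm_mul u v : sperm n := SPerm (sperm_mul_subproof u v).

Fact sperm_inv_subproof u : [forall x,
  (sperm_val u)^-1 (sneg x) == sneg ((sperm_val u)^-1 x)].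
Proof.
apply/forallP => x; apply/eqP/(@perm_inj _ u).
by rewrite spermN !permKV.
Qed.

Definition sperm_inv u : sperm n := SPerm (sperm_inv_subproof u).

Fact sperm_mulA : associative sperm_mul.
Proof. by move=> u v w; apply: val_inj; rewrite /= mulgA. Qed.

Fact sperm_mul1 : left_id sperm_one sperm_mul.
Proof. by move=> u; apply: val_inj; rewrite /= mulg1. Qed.

Fact sperm_mulV : left_inverse sperm_one sperm_inv sperm_mul.
Proof. by move=> u; apply: val_inj; rewrite /= mulgV. Qed.

HB.instance Definition _ :=
  Finite_isGroup.Build (sperm n) sperm_mulA sperm_mul1 sperm_mulV.

Lemma spermM u v x : (u * v) x = u (v x).
Proof. by rewrite permM. Qed.

Lemma sperm1 x : (1 : sperm n) x = x.
Proof. by rewrite perm1. Qed.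

(* [w] as a function on integers, extended by the identity outside
   {±1, ..., ±(n+1)}. *)
Definition int_fun w (z : int) : int :=
  if insub z is Some x then spoint_val (w x) else z.

Lemma int_fun_pt w z : 0 < `|z|%N <= n.+1 -> int_fun w z = w (pt n z).
Proof.
move=> hz; rewrite /int_fun; case: insubP => [x _ xz|]; last by rewrite hz.
by congr (spoint_val (w _)); apply: val_inj; rewrite [RHS]val_pt.
Qed.

End SPerm.

Section Coxeter.
Variable n : nat.
Implicit Types (i j : 'I_n.+1) (u v w : sperm n) (a : seq 'I_n.+1).

Definition simple_perm i : {perm spoint n} :=
  if i == 0%N :> nat then tperm (pt n 1%Z) (pt n (-1)%Z)
  else tperm (pt n (Posz i)) (pt n (Posz i.+1)) *
       tperm (pt n (- Posz i)%R) (pt n (- Posz i.+1)%R).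

Lemma simple_permC (m : nat) : 0 < m <= n ->
  commute (tperm (pt n (Posz m)) (pt n (Posz m.+1)))
          (tperm (pt n (- Posz m)%R) (pt n (- Posz m.+1)%R)).
Proof.
move=> hm; apply/commgP/conjg_fixP; rewrite tpermJ !tpermD //.
all: by apply/eqP => /(congr1 (@spoint_val n)); rewrite !val_pt; lia.
Qed.

Fact simple_subproof i :
  [forall x, simple_perm i (sneg x) == sneg (simple_perm i x)].
Proof.
apply/forallP => x; apply/eqP; rewrite /simple_perm.
have inj := inv_inj (@snegK n).
case: eqP => [_|/eqP i0].
  by rewrite (inj_tperm _ _ _ inj) !sneg_pt // tpermC.
have hi := ltn_ord i.
rewrite !permM (inj_tperm _ _ _ inj) (inj_tperm _ _ _ inj).
rewrite !sneg_pt ?opprK; try by lia.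
by rewrite -!permM simple_permC //; lia.
Qed.

Definition simple_refl i : sperm n := SPerm (simple_subproof i).

Definition word_prod a : sperm n := \prod_(i <- a) simple_refl i.

Lemma simple0_pt i : i = 0%N :> nat ->
  forall m : 'I_n.+1,
  simple_refl i (pt n (Posz m.+1)) =
    if m == 0%N :> nat then pt n (-1)%Z else pt n (Posz m.+1).
Proof.
move=> i0 m; rewrite /= /simple_perm i0 /=.
case: eqP => [->|/eqP m0]; first by rewrite tpermL.
by rewrite tpermD //; apply/eqP => /(congr1 (@spoint_val n));
   rewrite !val_pt; have := ltn_ord m; lia.
Qed.

Lemma simpleS_pt i : i != 0%N :> nat ->
  forall m : 'I_n.+1,
  simple_refl i (pt n (Posz m.+1)) =
    pt n (Posz (if m.+1 == i then i.+1 else if m == i :> nat then i : nat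
                else m.+1)).
Proof.
move=> i0 m; rewrite /= /simple_perm (negPf i0) permM.
have := ltn_ord m; have := ltn_ord i => hi hm.
have D (z t : int) : 0 < `|z|%N <= n.+1 -> 0 < `|t|%N <= n.+1 -> z != t ->
    pt n z != pt n t.
  move=> hz ht; apply: contraNneq => /(congr1 (@spoint_val n)).
  by rewrite !val_pt // => ->.
case: eqP => [->|/eqP m1]; first by rewrite tpermL tpermD // D; lia.
case: eqP => [->|/eqP m2]; first by rewrite tpermR tpermD // D; lia.
by rewrite !tpermD // D; lia.
Qed.

Lemma simpleK i : simple_refl i * simple_refl i = 1.
Proof.
apply: spermP => x; rewrite sperm1 spermM /= /simple_perm.
case: eqP => [_|/eqP i0]; first by rewrite tpermK.
rewrite -permM; set p := tperm _ _; set q := tperm _ _.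
have C : p * q = q * p by apply: simple_permC; have := ltn_ord i; lia.
by rewrite {1}C -mulgA (mulgA p) tperm2 mul1g tperm2 perm1.
Qed.

Definition sperm_weight w : int :=
  (\sum_(m < n.+1) Posz m.+1 * spoint_val (w (pt n (Posz m.+1))))%R.

Lemma sperm_weight0 w i : i = 0%N :> nat ->
  (spoint_val (w (pt n 1%Z)) < 0)%R ->
  (sperm_weight w < sperm_weight (w * simple_refl i)%g)%R.
Proof.
move=> i0 hw.
have -> : sperm_weight (w * simple_refl i)%g = (\sum_(m < n.+1) Posz m.+1 *
    spoint_val (w (if m == 0%N :> nat then pt n (-1)%Z
                   else pt n (Posz m.+1))))%R.
  by apply: eq_bigr => m _; rewrite spermM simple0_pt.
rewrite /sperm_weight (bigD1 i) //= [ltRHS](bigD1 i) //= i0 /=.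
have -> : pt n (-1)%Z = sneg (pt n 1%Z) by rewrite sneg_pt.
rewrite spermN /=.
rewrite [X in (_ < _ + X)%R](eq_bigr (fun m : 'I_n.+1 =>
    Posz m.+1 * spoint_val (w (pt n (Posz m.+1))))%R) => [|m mi]; last first.
  case: eqP => // m0; by case/eqP: mi; apply: val_inj; rewrite /= m0 i0.
by rewrite ltrD2r !mul1r (lt_trans hw) // oppr_gt0.
Qed.

Lemma sperm_weightS w i : i != 0%N :> nat ->
  (spoint_val (w (pt n (Posz i.+1))) < spoint_val (w (pt n (Posz i))))%R ->
  (sperm_weight w < sperm_weight (w * simple_refl i)%g)%R.
Proof.
move=> i0 hw; have hi := ltn_ord i.
have hk : i.-1 < n.+1 by lia.
pose k := Ordinal hk.
have ki : k != i by apply/eqP => /(congr1 val) /=; lia.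
have kE : i.-1.+1 = i by lia.
have -> : sperm_weight (w * simple_refl i)%g = (\sum_(m < n.+1) Posz m.+1 *
    spoint_val (w (pt n (Posz (if m.+1 == i then i.+1
                               else if m == i :> nat then i : nat
                               else m.+1)))))%R.
  by apply: eq_bigr => m _; rewrite spermM simpleS_pt.
rewrite /sperm_weight (bigD1 i) //= (bigD1 k) //=.
rewrite [ltRHS](bigD1 i) //= [in ltRHS](bigD1 k) //= kE !eqxx.
rewrite (_ : (i.+1 == i) = false); last by lia.
rewrite [X in (_ < _ + (_ + X))%R](eq_bigr (fun m : 'I_n.+1 =>
    Posz m.+1 * spoint_val (w (pt n (Posz m.+1))))%R) => [|m mik]; last first.
  case/andP: mik => mi mk.
  case: eqP => [mE|_]; first by case/eqP: mk; apply: val_inj => /=; lia.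
  by case: eqP => // mE; case/eqP: mi; apply: val_inj.
rewrite !addrA ltrD2r; nia.
Qed.

Lemma sperm_increasing w :
  (0 < spoint_val (w (pt n 1%Z)))%R ->
  (forall i, i != 0%N :> nat ->
    spoint_val (w (pt n (Posz i))) < spoint_val (w (pt n (Posz i.+1))))%R ->
  w = 1.
Proof.
move=> h0 hS.
have lb m : m < n.+1 ->
    (Posz m.+1 <= spoint_val (w (pt n (Posz m.+1))))%R.
  elim: m => [|m IH] hm; first by move: h0; lia.
  have := hS (Ordinal hm) isT; rewrite /=; have := IH (ltnW hm); lia.
have ub k : k < n.+1 ->
    (spoint_val (w (pt n (Posz (n.+1 - k)))) <= Posz (n.+1 - k))%R.
  elim: k => [|k IH] hk.
    by rewrite subn0; case: (w _) => z /=; lia.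
  have hk' : n.+1 - k.+1 < n.+1 by lia.
  have := hS (Ordinal hk').
  rewrite /= (_ : (n.+1 - k.+1).+1 = n.+1 - k); last by lia.
  by have := IH (ltnW hk); lia.
have fixp m : 0 < m <= n.+1 -> w (pt n (Posz m)) = pt n (Posz m).
  move=> hm; apply: val_inj; rewrite /= val_pt //.
  have := lb m.-1; have := ub (n.+1 - m).
  by rewrite subKn ?prednK; lia.
apply: spermP => x; rewrite sperm1.
case: x => z hz.
have -> : SPoint hz = pt n z by apply: val_inj; rewrite /= val_pt.
case: z hz => m hm; first by apply: fixp; lia.
have -> : pt n (Negz m) = sneg (pt n (Posz m.+1)).
  by rewrite sneg_pt // NegzE.
by rewrite spermN fixp.
Qed.

Lemma word_prod_surj w : exists a, word_prod a = w.
Proof.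
pose G := <<[set simple_refl i | i : 'I_n.+1]>>.
have sG i : simple_refl i \in G by apply/mem_gen/imset_f.
suff /gen_prodgP[k [c cS ->]] : w \in G.
  have {cS} cS m : exists i, simple_refl i == c m.
    by case/imsetP: (cS m) => i _ ->; exists i.
  exists [seq xchoose (cS m) | m <- index_enum 'I_k].
  rewrite /word_prod big_map; apply: eq_bigr => m _.
  exact/eqP/(xchooseP (cS m)).
case: (@Order.TotalTheory.arg_maxP _ _ _ 1 (mem G)
         (fun u => sperm_weight (w * u))) => [|u uG umax]; first exact: group1.
have {}umax i :
    (sperm_weight (w * u * simple_refl i)%g <= sperm_weight (w * u)%g)%R.
  by rewrite -mulgA; apply: umax; apply: groupM.
have pt_ne0 (x : spoint n) : spoint_val x != 0%R by case: x => -[[]|].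
suff wu1 : w * u = 1 by rewrite -(mulgK u w) wu1 mul1g groupV.
apply: sperm_increasing => [|i i0].
  rewrite lt_neqAle eq_sym pt_ne0 leNgt; apply/negP => h.
  by have := umax ord0; rewrite leNgt sperm_weight0.
rewrite lt_neqAle leNgt; apply/andP; split; last first.
  by apply/negP => h; have := umax i; rewrite leNgt sperm_weightS.
have hi := ltn_ord i.
apply/eqP => /val_inj/perm_inj/(congr1 (@spoint_val n)).
by rewrite !val_pt; lia.
Qed.

Fact cox_length_subproof w :
  exists l, [exists a : l.-tuple 'I_n.+1, word_prod a == w].
Proof.
have [a <-] := word_prod_surj w.
by exists (size a); apply/existsP; exists (in_tuple a).
Qed.

Definition cox_length w : nat := ex_minn (cox_length_subproof w).

Lemma cox_length_le a : cox_length (word_prod a) <= size a.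
Proof.
rewrite /cox_length; case: ex_minnP => l _; apply.
by apply/existsP; exists (in_tuple a).
Qed.

Definition is_reduced_expr a w : bool :=
  (word_prod a == w) && (size a == cox_length w).

Lemma reduced_exprP w : exists a, is_reduced_expr a w.
Proof.
rewrite /is_reduced_expr /cox_length; case: ex_minnP => l /existsP[a aw] _.
by exists a; rewrite aw size_tuple eqxx.
Qed.

Definition left_descents w : {set 'I_n.+1} :=
  [set i | cox_length (simple_refl i * w) < cox_length w].

Definition right_descents w : {set 'I_n.+1} :=
  [set i | cox_length (w * simple_refl i) < cox_length w].

Definition reflections : {set sperm n} :=
  [set simple_refl i ^ v | i : 'I_n.+1, v : sperm n].

Definition bruhat_step : rel (sperm n) :=
  fun u w => (u^-1 * w \in reflections) && (cox_length u < cox_length w).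

Definition bruhat_le : rel (sperm n) := connect bruhat_step.

Fact bruhat_le_length u w :
  bruhat_le u w -> (u == w) || (cox_length u < cox_length w).
Proof.
case/connectP => p; elim: p u => [|v p IH] u /=.
  by move=> _ ->; rewrite eqxx.
case/andP => /andP[_ uv] /IH{}IH /IH/orP[/eqP<-|vw]; apply/orP; right=> //.
exact: ltn_trans vw.
Qed.

Fact bruhat_le_anti : antisymmetric bruhat_le.
Proof.
move=> u w /andP[/bruhat_le_length/orP[/eqP//|uw]].
case/bruhat_le_length/orP => [/eqP//|wu].
by move: (ltn_trans uw wu); rewrite ltnn.
Qed.

End Coxeter.

Fact bruhat_display : Order.disp_t. Proof. exact: Order.Disp tt tt. Qed.

HB.instance Definition _ n := Order.Le_isPOrder.Build bruhat_display (sperm n)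
  (@connect0 _ (@bruhat_step n)) (@bruhat_le_anti n)
  (@connect_trans _ (@bruhat_step n)).

Lemma le_bruhatE n (u w : sperm n) : (u <= w)%O = bruhat_le u w.
Proof. by []. Qed.

Section JoinIrreducible.
Variable n : nat.
Implicit Types (w : sperm n) (U : {set sperm n}).

Definition is_sup U w : bool :=
  [forall u in U, (u <= w)%O] &&
  [forall v : sperm n, [forall u in U, (u <= v)%O] ==> (w <= v)%O].

Definition join_irreducible w : bool :=
  ~~ [exists U : {set sperm n}, is_sup U w && (w \notin U)].

Definition JI (i j : 'I_n.+1) : {set sperm n} :=
  [set w | [&& join_irreducible w, left_descents w == [set i]
             & right_descents w == [set j]]].

End JoinIrreducible.

Section Bk.
Variable n : nat.

(* The letters of s_ij; meaningful for [i, j <= n]. *)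
Definition path_word (i j : nat) : seq 'I_n.+1 :=
  if i <= j then [seq l : 'I_n.+1 <- enum 'I_n.+1 | i <= l <= j]
  else rev [seq l : 'I_n.+1 <- enum 'I_n.+1 | j <= l <= i].

Definition b_factors (j k : nat) : seq (seq 'I_n.+1) :=
  [seq path_word m 0 | m <- iota 0 k] ++
  [seq path_word (k + m - 1) m | m <- iota 1 j].

Definition bk (j k : nat) : sperm n := \prod_(a <- b_factors j k) word_prod a.

End Bk.

(* Main.v *)
Require Import Defs.
From mathcomp Require Import all_boot all_order all_algebra all_fingroup.
From mathcomp Require Import zify.

(** Write N = n + 1 and, for a signed permutation w, let f(w) be the number of
positions z > j at which w is negative ([negatives]).  Everything follows from
the behaviour of this one statistic.  Let I be the set of simple reflections
other than 0 and J the set of those other than j.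

Double cosets.  Multiplying w on the left by a reflection in I, or on the
right by one in J, does not change f, and f in fact separates the double
cosets of W_I and W_J.  An element with left descents in {0} and right
descents in {j} is increasing at the positions above j, so f determines which
of its values are negative; the left condition then determines the order of
the values ([bigrassmannian_unique]).  Since b_k is such an element with
f(b_k) = k, stripping off descents other than 0 on the left and j on the right
shows b_{f(w)} <= w as soon as f(w) > 0 ([bk_le]).  In particular the elements
whose only left descent is 0 and only right descent is j are the b_k.

Monotonicity.  If u < w is a Bruhat step, then w arises from u by exchanging
the values at two positions x < y, and at the opposite positions, where u is
increasing; this cannot lower f ([negatives_le]).  What is needed here is that
a reflection lengthens u exactly when u is increasing on the pair that it
exchanges.  That is the strong exchange property, proved on a word for u by
looking for the letter that inverts the pair ([exchange_word]).

Chain.  The element 0 b_{k+1} lies below b_{k+1} and has f = k, so it lies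
above b_k ([bk_ltS]).

Join-irreducibility.  Left multiplication by the longest element w0 = -1
reverses the Bruhat order and replaces f by N - j - f.  So every u with
f(u) < k satisfies u <= v, where v = w0 b_{N-j-k+1}, and f(v) = k - 1.  An
element u < b_k has f(u) <= k by monotonicity, and f(u) = k would give
b_k <= u; hence v bounds every element strictly below b_k, but
f(v) < k = f(b_k) excludes b_k <= v.  So b_k is not a supremum of elements
strictly below it ([bk_join_irreducible]).

The explicit form of b_k comes from composing the factors, each of which moves
one value down to the front of a block of smaller values; every letter of such
a factor creates an ascent, whence the reducedness of the word. *)

Section Bigrassmannian.
Import Order.TTheory GRing.Theory Num.Theory GroupScope.
Set Implicit Arguments.
Unset Strict Implicit.

Variable n : nat.
Implicit Types (i : 'I_n.+1) (x y z : spoint n) (u v w t : sperm n).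
Implicit Types (a : seq 'I_n.+1).

Local Notation "x <s y" := (spoint_val x < spoint_val y)%R (at level 70).
Local Notation l := (@cox_length n).
Local Notation s_ i := (@simple_refl n i).

(** * Simple reflections as swaps *)

Lemma spoint_range x : 0 < `|spoint_val x|%N <= n.+1.
Proof. by case: x. Qed.

Lemma spoint_eqE x y : (x == y) = (spoint_val x == spoint_val y).
Proof. by []. Qed.

Lemma spoint_inj x y : spoint_val x = spoint_val y -> x = y.
Proof. exact: val_inj. Qed.

Lemma pt_val x : pt n (spoint_val x) = x.
Proof. by apply: val_inj; rewrite /= val_pt ?spoint_range. Qed.

Lemma spermK w : cancel w (w^-1)%g.
Proof. by move=> x; rewrite -spermM mulVg sperm1. Qed.

Lemma spermKV w : cancel (w^-1)%g w.
Proof. by move=> x; rewrite -spermM mulgV sperm1. Qed.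

(** For the order of the integers, [lo i] and [hi i] are consecutive among
the points (0 is not one of them); the reflection i exchanges them, and their
opposites.  Taking [lo 0 = -1], rather than a separate sign condition at 1,
treats the reflection 0 like the others. *)
Definition lo i : spoint n :=
  if i == 0%N :> nat then pt n (-1)%Z else pt n (Posz i).
Definition hi i : spoint n := pt n (Posz i.+1).

Lemma val_lo i : spoint_val (lo i) = if i == 0%N :> nat then (-1)%Z else Posz i.
Proof.
by rewrite /lo; have := ltn_ord i; case: eqP => ? ?; rewrite val_pt; lia.
Qed.

Lemma val_hi i : spoint_val (hi i) = Posz i.+1.
Proof. by rewrite /hi; have := ltn_ord i => ?; rewrite val_pt; lia. Qed.

(** The reflection exchanging x with y and -x with -y; for y = -x it is a
single sign change. *)
Definition swap x y z : spoint n :=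
  if z == x then y else if z == y then x else
  if z == sneg x then sneg y else if z == sneg y then sneg x else z.

Lemma swap_conj v x y z : swap (v x) (v y) (v z) = v (swap x y z).
Proof.
rewrite /swap -!spermN !(inj_eq perm_inj).
by do 4?case: ifP => _.
Qed.

Lemma simple_val i z : spoint_val (s_ i z) =
  let z' := spoint_val z in
  if i == 0%N :> nat then if `|z'|%N == 1%N then (- z')%R else z'
  else if z' == Posz i then Posz i.+1 else if z' == Posz i.+1 then Posz i
  else if z' == (- Posz i)%R then (- Posz i.+1)%R
  else if z' == (- Posz i.+1)%R then (- Posz i)%R else z'.
Proof.
have hi_ := ltn_ord i; have hz := spoint_range z.
rewrite /= /simple_perm; case: eqP => [i0|/eqP i0].
  rewrite permE /= !spoint_eqE !val_pt //.
  by do ?case: ifP; rewrite ?val_pt //; lia.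
rewrite permM [X in tperm _ _ X]permE /= !spoint_eqE.
rewrite permE /= !spoint_eqE !val_pt; try lia.
by do ?case: ifP; rewrite ?val_pt; try lia; do ?case: ifP; rewrite ?val_pt; lia.
Qed.

Lemma simple_swap i z : s_ i z = swap (lo i) (hi i) z.
Proof.
have hi_ := ltn_ord i; have hz := spoint_range z.
apply: spoint_inj; rewrite simple_val /swap !spoint_eqE /= val_hi val_lo.
by do ?case: ifP; rewrite /= ?val_hi ?val_lo; do ?case: ifP; lia.
Qed.

Lemma swapC x y z : swap x y z = swap y x z.
Proof.
rewrite /swap; case: eqP => [->|_]; first by case: eqP => // ->.
case: eqP => // _; case: eqP => [->|_]; last by case: eqP.
by case: eqP => // ->.
Qed.

Lemma swap_neg x y z : swap (sneg x) (sneg y) z = swap x y z.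
Proof.
have hz := spoint_range z; have hx := spoint_range x; have hy := spoint_range y.
apply: spoint_inj; rewrite /swap !spoint_eqE /=.
by do ?case: ifP => /= ?; lia.
Qed.

Lemma swapK x y : involutive (swap x y).
Proof.
move=> z; have hz := spoint_range z; apply: spoint_inj.
have hx := spoint_range x; have hy := spoint_range y.
rewrite [X in swap x y X]/swap !spoint_eqE /=.
by do ?case: ifP => ?; rewrite /swap !spoint_eqE /=; do ?case: ifP => /= ?; lia.
Qed.

(** As [lo i] and [hi i] are consecutive, they and their opposites form the
only pairs whose order is inverted by the reflection i. *)
Lemma simple_crossing i x y : x <s y -> s_ i y <s s_ i x ->
  forall z, swap x y z = s_ i z.
Proof.
move=> xy; have hx := spoint_range x; have hy := spoint_range y.
rewrite !simple_val /= => sxy z; rewrite simple_swap.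
suff [[-> ->]//|[-> ->]] : (x = lo i /\ y = hi i) \/
    (x = sneg (hi i) /\ y = sneg (lo i)).
  by rewrite swap_neg swapC.
have E x' y' : (spoint_val x' = spoint_val y') <-> x' = y'.
  by split=> [/val_inj|->].
rewrite -!E /= val_hi val_lo.
move: sxy; do ?case: ifP => /= ?; lia.
Qed.

(** * Strong exchange, and descents read off the values *)

Lemma word_prod_rcons a i : word_prod (rcons a i) = word_prod a * s_ i.
Proof. by rewrite /word_prod -cats1 big_cat big_seq1. Qed.

Lemma length_mulr w i : l (w * s_ i) <= (l w).+1.
Proof.
have [a /andP[/eqP <- /eqP <-]] := reduced_exprP w.
rewrite -word_prod_rcons.
by apply: leq_trans (cox_length_le _) _; rewrite size_rcons.
Qed.

(** Reading the word from the right, some letter must be the first to put x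
and y in the wrong order.  By [simple_crossing] that letter is t transported by
the letters after it, so multiplying by t deletes it from the word. *)
Lemma exchange_word a x y t : x <s y -> word_prod a y <s word_prod a x ->
  (forall z, t z = swap x y z) -> l (word_prod a * t) < size a.
Proof.
elim/last_ind: a x y t => [|a i IH] x y t xy.
  by rewrite /word_prod big_nil !sperm1; lia.
rewrite word_prod_rcons !spermM size_rcons ltnS => ayx tE.
have [sxy|syx|] := ltgtP (spoint_val (s_ i x)) (spoint_val (s_ i y)).
- pose t' := s_ i * t * s_ i.
  have -> : word_prod a * s_ i * t = word_prod a * t' * s_ i.
    by rewrite /t' -!mulgA simpleK mulg1.
  apply: leq_trans (length_mulr _ _) _; apply: (IH _ _ _ sxy ayx) => z.
  by rewrite /t' !spermM tE -swap_conj -spermM simpleK sperm1.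
- have -> : t = s_ i by apply: spermP => z; rewrite tE (simple_crossing xy syx).
  by rewrite -mulgA simpleK mulg1 cox_length_le.
- by move/val_inj/perm_inj => exy; move: xy; rewrite exy ltxx.
Qed.

Lemma swap_descent w x y t : x <s y -> w y <s w x ->
  (forall z, t z = swap x y z) -> l (w * t) < l w.
Proof.
have [a /andP[/eqP <- /eqP <-]] := reduced_exprP w.
exact: exchange_word.
Qed.

Lemma swapL x y : swap x y x = y.
Proof. by rewrite /swap eqxx. Qed.

Lemma swapR x y : swap x y y = x.
Proof. by rewrite swapC swapL. Qed.

Lemma swap_length w x y t : x <s y -> (forall z, t z = swap x y z) ->
  (l w < l (w * t)) = (w x <s w y).
Proof.
move=> xy tE; have [wxy|wyx|/val_inj/perm_inj exy] :=
  ltgtP (spoint_val (w x)) (spoint_val (w y)).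
- have := @swap_descent (w * t) x y t xy; rewrite !spermM !tE swapL swapR.
  have -> : w * t * t = w; last by apply.
  rewrite -mulgA; suff -> : t * t = 1 by rewrite mulg1.
  by apply: spermP => z; rewrite spermM sperm1 !tE swapK.
- by apply/negP => ?; have := swap_descent xy wyx tE; lia.
- by move: xy; rewrite exy ltxx.
Qed.

Lemma swap_length_lt w x y t : x <s y -> (forall z, t z = swap x y z) ->
  (l (w * t) < l w) = (w y <s w x).
Proof.
move=> xy tE; have := swap_length (w * t) xy tE.
rewrite !spermM !tE swapL swapR => <-; congr (_ < l _).
rewrite -mulgA; suff -> : t * t = 1 by rewrite mulg1.
by apply: spermP => z; rewrite spermM sperm1 !tE swapK.
Qed.

Lemma conj_swap i v z :
  (s_ i ^ v) z = swap ((v^-1)%g (lo i)) ((v^-1)%g (hi i)) z.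
Proof.
by rewrite conjgE !spermM simple_swap -swap_conj spermK.
Qed.

(** For i = 0 this compares w(-1) with w(1), so it means w(1) > 0. *)
Definition ascent w i := w (lo i) <s w (hi i).

Lemma lo_lt_hi i : lo i <s hi i.
Proof. by rewrite val_lo val_hi; case: ifP; lia. Qed.

Lemma ascentPn w i : ~~ ascent w i = (w (hi i) <s w (lo i)).
Proof.
rewrite /ascent -leNgt le_eqVlt; case: eqP => // /spoint_inj/perm_inj e.
by have := lo_lt_hi i; rewrite e ltxx.
Qed.

Lemma length_right w i : (l w < l (w * s_ i)) = ascent w i.
Proof. exact: (swap_length _ (lo_lt_hi i) (simple_swap i)). Qed.

Lemma right_descentE w i : (i \in right_descents w) = ~~ ascent w i.
Proof.
by rewrite inE ascentPn (swap_length_lt _ (lo_lt_hi i) (simple_swap i)).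
Qed.

(** Left multiplication by a simple reflection is right multiplication by a
reflection, so left descents are also governed by [swap_length_lt]. *)
Lemma left_length w i : l (s_ i * w) = l (w * s_ i ^ w).
Proof. by rewrite -conjgC. Qed.

Lemma left_descentE w i : (i \in left_descents w) = ~~ ascent w^-1 i.
Proof.
rewrite inE left_length.
have [h|] := boolP (ascent w^-1 i).
  by rewrite (swap_length_lt w h (conj_swap i w)) !spermKV ltNge ltW ?lo_lt_hi.
rewrite ascentPn => h; rewrite (swap_length_lt w (t := s_ i ^ w) h) => [|z].
  by rewrite !spermKV lo_lt_hi.
by rewrite conj_swap swapC.
Qed.

Lemma bruhat_mulr w i : ~~ ascent w i -> (w * s_ i < w)%O.
Proof.
rewrite -right_descentE inE => h; rewrite lt_neqAle; apply/andP; split.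
  by apply: contraTneq h => ->; rewrite ltnn.
apply: connect1; rewrite /bruhat_step h andbT.
apply/imset2P; exists i 1; rewrite ?inE // conjg1 invMg -mulgA mulVg mulg1.
by rewrite -[LHS]mulg1 -(simpleK i) mulKg.
Qed.

Lemma bruhat_mull w i : ~~ ascent w^-1 i -> (s_ i * w < w)%O.
Proof.
rewrite -left_descentE inE => h; rewrite lt_neqAle; apply/andP; split.
  by apply: contraTneq h => ->; rewrite ltnn.
apply: connect1; rewrite /bruhat_step h andbT.
apply/imset2P; exists i w; rewrite ?inE // conjgE invMg -mulgA.
by congr (_ * (_ * _)); rewrite -[LHS]mulg1 -(simpleK i) mulKg.
Qed.

(** * Monotonicity of the number of negative values beyond j *)

Lemma bruhat_step_swap u w : bruhat_step u w ->
  exists x y, [/\ x <s y, u x <s u y & forall z, (u^-1 * w)%g z = swap x y z].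
Proof.
case/andP => /imset2P[i v _ _ e] luw; rewrite e.
have ew : w = u * s_ i ^ v by rewrite -e mulKVg.
pose x := (v^-1)%g (lo i); pose y := (v^-1)%g (hi i).
have [xy|yx|/spoint_inj/perm_inj exy] := ltgtP (spoint_val x) (spoint_val y).
- exists x, y; split=> // [|z]; last by rewrite conj_swap.
  by rewrite -(swap_length u xy (conj_swap i v)) -ew.
- exists y, x; split=> // [|z]; last by rewrite conj_swap swapC.
  by rewrite -(@swap_length u y x (s_ i ^ v)) -?ew // => z;
     rewrite conj_swap swapC.
- by have := lo_lt_hi i; rewrite exy ltxx.
Qed.

Definition negatives (j : nat) w :=
  [set z : spoint n | (Posz j < spoint_val z)%R && (spoint_val (w z) < 0)%R].

Lemma val_neg x : spoint_val (sneg x) = (- spoint_val x)%R.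
Proof. by []. Qed.

(** If the value at z stops being negative, then the value at the point that
is exchanged with z is negative afterwards, and because u increases from x to
y this point lies further right, so it still exceeds j. *)
Lemma negatives_step j u w : bruhat_step u w ->
  #|negatives j u| <= #|negatives j w|.
Proof.
case/bruhat_step_swap => x [y [xy uxy tE]].
have wE z : w z = u (swap x y z) by rewrite -tE -spermM mulKVg.
pose f z := if (spoint_val (w z) < 0)%R then z else swap x y z.
have fin z : z \in negatives j u -> f z \in negatives j w.
  rewrite !inE /f => /andP[jz uz].
  case: ifP => [->|]; first by rewrite jz.
  rewrite !wE swapK uz andbT /swap.
  have hz := spoint_range (u z).
  case: eqP => [zx|_]; first by move: jz; rewrite zx; lia.
  (* At y the value only decreases, so it stays negative; likewise at -x. *)
  case: eqP => [zy|_]; first by move: uz uxy; rewrite zy; lia.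
  case: eqP => [zx|_]; first by move: uz uxy; rewrite zx !spermN !val_neg; lia.
  case: eqP => [zy|_]; last by rewrite uz.
  by move: jz; rewrite zy !val_neg; lia.
rewrite -(@card_in_imset _ _ f).
  by apply/subset_leq_card/subsetP => _ /imsetP[z zN ->]; apply: fin.
move=> z z'; rewrite !inE /f => /andP[_ uz] /andP[_ uz'].
rewrite !wE; case: ifP => h; case: ifP => h' // e.
- by move: uz; rewrite e h'.
- by move: uz'; rewrite -e h.
- by rewrite -[z](swapK x y) e swapK.
Qed.

Lemma negatives_le j u w : (u <= w)%O -> #|negatives j u| <= #|negatives j w|.
Proof.
case/connectP => p; elim: p u => [|v p IH] u /= => [_ -> //|].
by case/andP => /(negatives_step j) h /IH{}IH /IH; apply: leq_trans.
Qed.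

Lemma negatives_mull j w i : i != 0%N :> nat ->
  negatives j (s_ i * w) = negatives j w.
Proof.
move=> i0; apply/setP => z; rewrite !inE spermM simple_val /= (negPf i0).
by congr (_ && _); do ?case: ifP; lia.
Qed.

Lemma negatives_mulr (j : nat) w i : i != j :> nat ->
  #|negatives j (w * s_ i)| = #|negatives j w|.
Proof.
move=> ij; rewrite -(card_imset (negatives j w) (@perm_inj _ (s_ i))).
congr #|pred_of_set _|; apply/setP => z; rewrite !inE spermM.
rewrite -{3}[z](sperm1 z) -(simpleK i) spermM.
rewrite (mem_imset _ _ (@perm_inj _ (s_ i))).
rewrite !inE; congr (_ && _); rewrite simple_val /=.
have := spoint_range z; do ?case: ifP; lia.
Qed.

(** * Elements determined by their negative values *)

Lemma increasing_above (j : nat) w : (forall i, j < i -> ascent w i) ->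
  forall x y, (Posz j < spoint_val x)%R -> x <s y -> w x <s w y.
Proof.
move=> inc.
have step m d : j < m -> 0 < d -> m + d <= n.+1 ->
    w (pt n (Posz m)) <s w (pt n (Posz (m + d))).
  move=> jm; elim: d => // d IH _ hd.
  have hi_ : m + d < n.+1 by lia.
  have := inc (Ordinal hi_); rewrite /ascent /lo /hi /= -addnS.
  rewrite (_ : (m + d == 0) = false); last by lia.
  case: d IH {hi_} hd => [|d] IH hd /(_ _); first by rewrite addn0; apply; lia.
  by move/(_ ltac:(lia)); apply: lt_trans; apply: IH; lia.
move=> x y jx xy; have hy := spoint_range y.
rewrite -(pt_val x) -(pt_val y).
have -> : spoint_val x = Posz `|spoint_val x|%N by lia.
have -> : spoint_val y =
    Posz (`|spoint_val x|%N + (`|spoint_val y|%N - `|spoint_val x|%N)) by lia.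
by apply: step; lia.
Qed.

Lemma positive_below (j : nat) w : (forall i, i < j -> ascent w i) ->
  forall x, (0 < spoint_val x <= Posz j)%R -> (0 < spoint_val (w x))%R.
Proof.
move=> inc.
have step m : m < j -> m < n.+1 -> (0 < spoint_val (w (pt n (Posz m.+1))))%R.
  elim: m => [|m IH] mj hm.
    have := inc ord0 mj; rewrite /ascent /lo /hi /=.
    by rewrite -[pt n (-1)%Z](@sneg_pt n 1%Z) // spermN val_neg; lia.
  have := inc (Ordinal hm) mj; rewrite /ascent /lo /hi /=.
  by apply: lt_trans; apply: IH; lia.
move=> x hx; have rx := spoint_range x; rewrite -(pt_val x).
have -> : spoint_val x = Posz (`|spoint_val x|%N.-1).+1 by lia.
by apply: step; lia.
Qed.

(** The left descents lie in {0} and the right descents in {j}: the minimal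
elements of their double cosets, so the identity is included. *)
Definition bigrassmannian (j : nat) w :=
  (forall i, i != 0%N :> nat -> ascent w^-1 i) /\
  (forall i, i != j :> nat -> ascent w i).

(** Two initial segments of the points beyond j are nested; this is why their
cardinals suffice to compare them in [negatives_eq]. *)
Lemma negatives_initial j w x y : bigrassmannian j w ->
  y \in negatives j w -> (Posz j < spoint_val x)%R -> x <s y ->
  x \in negatives j w.
Proof.
case=> _ inc; rewrite !inE => /andP[jy wy] jx xy; rewrite jx.
apply: lt_trans wy; apply: (increasing_above (j := j) _ jx xy) => i ji.
by apply: inc; lia.
Qed.

Lemma negatives_eq j u w : bigrassmannian j u -> bigrassmannian j w ->
  #|negatives j u| = #|negatives j w| -> negatives j u = negatives j w.
Proof.
move=> gu gw e; apply/eqP.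
have [s|/subsetPn[x xu xw]] := boolP (negatives j u \subset negatives j w).
  by rewrite eqEcard s e leqnn.
rewrite eq_sym eqEcard e leqnn andbT; apply/subsetP => y yw.
have [yu//|yu] := boolP (y \in negatives j u).
have jx : (Posz j < spoint_val x)%R by move: xu; rewrite inE => /andP[].
have jy : (Posz j < spoint_val y)%R by move: yw; rewrite inE => /andP[].
have [xy|yx|/spoint_inj exy] := ltgtP (spoint_val x) (spoint_val y).
- by rewrite (negatives_initial gw yw jx xy) in xw.
- by rewrite (negatives_initial gu xu jy yx) in yu.
- by rewrite exy yw in xw.
Qed.

Lemma bigrassmannian_signs j u w : bigrassmannian j u -> bigrassmannian j w ->
  #|negatives j u| = #|negatives j w| ->
  forall z, (spoint_val (u z) < 0)%R = (spoint_val (w z) < 0)%R.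
Proof.
move=> gu gw e.
have pos z : (0 < spoint_val z)%R ->
    (spoint_val (u z) < 0)%R = (spoint_val (w z) < 0)%R.
  move=> z0; have [zj|jz] := leP (spoint_val z) (Posz j).
    have z0j : (0 < spoint_val z <= Posz j)%R by rewrite z0.
    have wz : (0 < spoint_val (w z))%R.
      by apply: positive_below z0j => i ij; apply: gw.2; lia.
    have uz : (0 < spoint_val (u z))%R.
      by apply: positive_below z0j => i ij; apply: gu.2; lia.
    lia.
  have : (z \in negatives j u) = (z \in negatives j w).
    by rewrite (negatives_eq gu gw e).
  by rewrite !inE jz.
move=> z; have rz := spoint_range z.
have [z0|z0] := ltP 0%R (spoint_val z); first exact: pos.
have := pos (sneg z); rewrite !spermN !val_neg.
have := spoint_range (u z); have := spoint_range (w z); lia.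
Qed.

(** The product w u^-1 keeps positive values positive, because u and w are
negative at the same points, and it is increasing on them, because u^-1 and
w^-1 are.  Hence it is the identity. *)
Lemma bigrassmannian_unique j u w : bigrassmannian j u -> bigrassmannian j w ->
  #|negatives j u| = #|negatives j w| -> u = w.
Proof.
move=> gu gw e; have sgn := bigrassmannian_signs gu gw e.
apply/esym/eqP; rewrite -(can_eq (mulgKV u)) mulgV; apply/eqP.
have pos x : (0 < spoint_val x)%R -> (0 < spoint_val (w ((u^-1)%g x)))%R.
  move=> x0; have := sgn ((u^-1)%g x); rewrite spermKV.
  by have := spoint_range (w ((u^-1)%g x)); lia.
apply: sperm_increasing => [|i i0]; rewrite !spermM.
  by apply: pos; rewrite val_pt.
have hi_ := ltn_ord i.
set x := pt n (Posz i); set y := pt n (Posz i.+1).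
have xy : (u^-1)%g x <s (u^-1)%g y.
  by have := gu.1 i i0; rewrite /ascent /lo /hi (negPf i0).
have [//|yx|/spoint_inj/perm_inj/perm_inj exy] :=
  ltgtP (spoint_val (w ((u^-1)%g x)))
        (spoint_val (w ((u^-1)%g y))); last first.
  by move: xy; rewrite exy ltxx.
have incw : forall i : 'I_n.+1, 0 < i -> ascent w^-1 i.
  by move=> i' i'0; apply: gw.1; lia.
have y0 : (0 < spoint_val (w ((u^-1)%g y)))%R.
  by apply: pos; rewrite val_pt; lia.
have := increasing_above incw y0 yx; rewrite !spermK => h.
by have := lt_trans h xy; rewrite ltxx.
Qed.

(** * The longest element *)

Fact longest_subproof : [forall x : spoint n,
  perm (inv_inj (@snegK n)) (sneg x) == sneg (perm (inv_inj (@snegK n)) x)].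
Proof. by apply/forallP => x; rewrite !permE. Qed.

Definition longest : sperm n := SPerm longest_subproof.

Lemma longestM w x : (longest * w) x = sneg (w x).
Proof. by rewrite spermM /= permE. Qed.

Lemma longestK w : longest * (longest * w) = w.
Proof. by apply: spermP => x; rewrite !longestM snegK. Qed.

Lemma longest_anti u w : (u <= w)%O -> (longest * w <= longest * u)%O.
Proof.
case/connectP => p; elim: p u => [|v p IH] u /= => [_ -> //|].
case/andP => uv /IH{}IH /IH h; apply: le_trans h _; apply: connect1.
have [x [y [xy uxy tE]]] := bruhat_step_swap uv.
case/andP: uv => tR _; rewrite /bruhat_step.
have tV : v^-1 * u = u^-1 * v.
  have tt : (u^-1 * v) * (u^-1 * v) = 1.
    by apply: spermP => z; rewrite spermM sperm1 !tE swapK.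
  by rewrite -[LHS]mul1g -tt -!mulgA mulKVg mulVg mulg1.
have -> : (longest * v)^-1 * (longest * u) = u^-1 * v.
  by rewrite invMg -mulgA mulKg.
rewrite tR /=.
have -> : longest * v = longest * u * (u^-1 * v) by rewrite -mulgA mulKVg.
by rewrite (swap_length_lt _ xy tE) !longestM !val_neg; lia.
Qed.

Lemma card_interval (p q : nat) : p <= q <= n.+1 ->
  #|[set z : spoint n | (Posz p < spoint_val z <= Posz q)%R]| = q - p.
Proof.
move=> pq; pose f (m : 'I_(q - p)) := pt n (Posz (p + m).+1).
have fE m : spoint_val (f m) = Posz (p + m).+1.
  by rewrite val_pt; have := ltn_ord m; lia.
have finj : injective f.
  move=> m m' /(congr1 (@spoint_val n)); rewrite !fE => h.
  by apply: val_inj; rewrite /=; lia.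
rewrite -[RHS]card_ord -(card_imset _ finj); congr #|pred_of_set _|.
apply/setP => z; rewrite inE; apply/idP/imsetP => [hz|[m _ ->]].
  have hm : `|spoint_val z|%N - p.+1 < q - p by lia.
  by exists (Ordinal hm) => //; apply: spoint_inj; rewrite fE /=; lia.
by rewrite fE; have := ltn_ord m; lia.
Qed.

Lemma negatives_longest (j : nat) w : j <= n.+1 ->
  #|negatives j (longest * w)| + #|negatives j w| = n.+1 - j.
Proof.
move=> jn; have jn' : j <= n.+1 <= n.+1 by rewrite jn leqnn.
rewrite -(card_interval jn') -cardsUI.
have -> : negatives j (longest * w) :&: negatives j w = set0.
  by apply/setP => z; rewrite !inE longestM val_neg; lia.
rewrite cards0 addn0; congr #|pred_of_set _|; apply/setP => z.
rewrite !inE longestM val_neg.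
by have := spoint_range z; have := spoint_range (w z); lia.
Qed.

(** * Explicit form and reducedness of the elements b_k *)

(** The values of the word m (m-1) ... p.  For p = 0 the letter 0 changes the
sign of the point that has reached position 1, whence the exclusive or. *)
Definition down_fun (p m : nat) (z : int) : int :=
  let q := maxn p 1 in
  if `|z|%N == q then
    (if (0 < z)%R (+) (p == 0%N) then Posz m.+1 else - Posz m.+1)%R
  else if q < `|z|%N <= m.+1 then (if (0 < z)%R then z - 1 else z + 1)%R
  else z.

Lemma iotaS_cat p d : iota p d.+1 = iota p d ++ [:: p + d].
Proof. by rewrite -addn1 iotaD. Qed.

Lemma rev_iotaS p d : rev (iota p d.+1) = p + d :: rev (iota p d).
Proof. by rewrite iotaS_cat rev_cat. Qed.

Lemma down_word_val p d a : map val a = rev (iota p d.+1) ->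
  forall z, spoint_val (word_prod a z) = down_fun p (p + d) (spoint_val z).
Proof.
elim: d a => [|d IH] [|i a]; rewrite rev_iotaS //= => -[ei ea] z.
  case: a ea => // _; rewrite /word_prod big_seq1 simple_val /= /down_fun.
  have := spoint_range z; rewrite ei addn0.
  by do ?case: ifP; lia.
rewrite /word_prod big_cons spermM simple_val /= -/(word_prod a) IH //.
rewrite ei; have hz := spoint_range z.
move E: (down_fun p (p + d) _) => y; move: E; rewrite /down_fun.
by do ?case: ifP => ?; lia.
Qed.

(** The value of w at p + d + 1 travels left past the values at p + d, ..., p,
and finally changes sign when p = 0; the hypothesis makes each of these moves
length-increasing. *)
Lemma down_word_length p d a w : map val a = rev (iota p d.+1) ->
  (forall q, p <= q <= p + d ->
     if q == 0 then (0 < spoint_val (w (pt n (Posz (p + d).+1))))%R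
     else w (pt n (Posz q)) <s w (pt n (Posz (p + d).+1))) ->
  l (w * word_prod a) = l w + d.+1.
Proof.
have step v i : ascent v i -> l (v * s_ i) = (l v).+1.
  by rewrite -length_right => h; apply/eqP; rewrite eqn_leq length_mulr h.
elim: d a w => [|d IH] [|i a] w; rewrite rev_iotaS //= => -[ei ea] h.
  case: a ea => // _; rewrite /word_prod big_seq1 addn1; apply: step.
  have := h p; rewrite addn0 leqnn /= /ascent /lo /hi ei addn0 => /(_ isT).
  case: ifP => // p0.
  by rewrite -[pt n (-1)%Z](@sneg_pt n 1%Z) // spermN val_neg (eqP p0); lia.
have hi_ := ltn_ord i.
rewrite /word_prod big_cons mulgA -/(word_prod a) IH //.
  rewrite step ?addSnnS // /ascent /lo /hi ei.
  by have := h (p + d.+1); rewrite leqnn leq_addr; case: eqP => //; lia.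
move=> q hq; have := h q; rewrite !spermM.
have sE m m' : 0 < m <= n.+1 -> 0 < m' <= n.+1 ->
    (if m == p + d.+1 then (p + d.+1).+1
     else if m == (p + d.+1).+1 then p + d.+1 else m) = m' ->
    s_ i (pt n (Posz m)) = pt n (Posz m').
  move=> hm hm' e; apply: spoint_inj; rewrite simple_val /= !val_pt // ei -e.
  by do ?case: ifP; lia.
rewrite (sE (p + d).+1 (p + d.+1).+1); [|lia|lia|]; last by do ?case: ifP; lia.
case: eqP => q0; first by apply; lia.
by rewrite (sE q q); [apply; lia|lia|lia|do ?case: ifP; lia].
Qed.

Lemma val_path_word m p : p <= m <= n ->
  map val (path_word n m p) = rev (iota p (m - p).+1).
Proof.
move=> pm.
have F (p' m' : nat) : p' <= m' <= n ->
    map val [seq i : 'I_n.+1 <- enum 'I_n.+1 | p' <= i <= m'] =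
    iota p' (m' - p').+1.
  move=> pm'; have -> : (fun i : 'I_n.+1 => p' <= i <= m') =
    preim val (fun k : nat => p' <= k <= m') by [].
  rewrite -filter_map val_enum_ord.
  apply: (irr_sorted_eq ltn_trans ltnn).
  - by apply: sorted_filter; [exact: ltn_trans | exact: iota_ltn_sorted].
  - exact: iota_ltn_sorted.
  by move=> k; rewrite mem_filter !mem_iota; lia.
rewrite /path_word; case: leqP => mp; last by rewrite map_rev F //; lia.
by have -> : m = p; [lia|]; rewrite F ?subnn //; lia.
Qed.

Lemma b_factors0S k :
  b_factors n 0 k.+1 = b_factors n 0 k ++ [:: path_word n k 0].
Proof. by rewrite /b_factors iotaS_cat map_cat /= !cats0. Qed.

Lemma b_factorsS j k :
  b_factors n j.+1 k = b_factors n j k ++ [:: path_word n (k + j) j.+1].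
Proof.
by rewrite /b_factors [iota 1 _]iotaS_cat map_cat catA /= add1n addnS subn1.
Qed.

Lemma bk0S k : bk n 0 k.+1 = bk n 0 k * word_prod (path_word n k 0).
Proof. by rewrite /bk b_factors0S big_cat big_seq1. Qed.

Lemma bkS j k : bk n j.+1 k = bk n j k * word_prod (path_word n (k + j) j.+1).
Proof. by rewrite /bk b_factorsS big_cat big_seq1. Qed.

(** The odd extension of the announced formula: on the block of positions
j+1, ..., j+k the values -k, ..., -1 are the positions minus j+k+1. *)
Definition bk_fun (j k : nat) (z : int) : int :=
  if `|z|%N <= j then (if (0 < z)%R then z + Posz k else z - Posz k)%R
  else if `|z|%N <= j + k then
    (if (0 < z)%R then z - Posz (j + k).+1 else z + Posz (j + k).+1)%R
  else z.

Lemma bk_val0 k : k <= n.+1 ->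
  forall z, spoint_val (bk n 0 k z) = bk_fun 0 k (spoint_val z).
Proof.
elim: k => [|k IH] hk z.
  rewrite /bk /b_factors big_nil sperm1 /bk_fun.
  by have := spoint_range z; do ?case: ifP; lia.
rewrite bk0S spermM IH; last by lia.
rewrite (@down_word_val 0 k) ?val_path_word ?subn0 //.
have hz := spoint_range z.
move E: (down_fun _ _ _) => y; move: E; rewrite /down_fun /bk_fun.
by do ?case: ifP => ?; lia.
Qed.

Lemma bk_val j k : 0 < k -> j + k <= n.+1 ->
  forall z, spoint_val (bk n j k z) = bk_fun j k (spoint_val z).
Proof.
move=> k0; elim: j => [|j IH] hk z; first exact: bk_val0.
rewrite bkS spermM IH; last by lia.
rewrite (@down_word_val j.+1 (k + j - j.+1)) ?val_path_word //; last by lia.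
have hz := spoint_range z.
move E: (down_fun _ _ _) => y; move: E; rewrite /down_fun /bk_fun.
by do ?case: ifP => ?; lia.
Qed.

Lemma word_prod_flatten (fs : seq (seq 'I_n.+1)) :
  word_prod (flatten fs) = \prod_(a <- fs) word_prod a.
Proof.
elim: fs => [|a fs IH]; first by rewrite /word_prod !big_nil.
by rewrite big_cons -IH /word_prod /= big_cat.
Qed.

Lemma size_path_word m p : p <= m <= n -> size (path_word n m p) = (m - p).+1.
Proof.
by move/val_path_word/(congr1 size); rewrite size_map size_rev size_iota.
Qed.

Lemma length1 : l 1 = 0.
Proof.
apply/eqP; rewrite -leqn0.
by have := @cox_length_le n [::]; rewrite /word_prod big_nil.
Qed.

Lemma bk_length0 k : k <= n.+1 ->
  l (bk n 0 k) = size (flatten (b_factors n 0 k)).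
Proof.
elim: k => [|k IH] hk; first by rewrite /bk /b_factors big_nil length1.
rewrite bk0S (@down_word_length 0 k) ?val_path_word ?subn0 //; last first.
  move=> q hq; case: eqP => q0; rewrite !bk_val0 ?val_pt /bk_fun; try lia.
    by do ?case: ifP; lia.
  by do ?case: ifP; lia.
rewrite IH; last by lia.
by rewrite b_factors0S flatten_cat size_cat /= cats0 size_path_word // subn0.
Qed.

Lemma bk_length j k : 0 < k -> j + k <= n.+1 ->
  l (bk n j k) = size (flatten (b_factors n j k)).
Proof.
move=> k0; elim: j => [|j IH] hk; first exact: bk_length0.
rewrite bkS (@down_word_length j.+1 (k + j - j.+1)) ?val_path_word //; try lia.
  rewrite IH; last by lia.
  by rewrite b_factorsS flatten_cat size_cat /= cats0 size_path_word; lia.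
move=> q hq; rewrite (_ : (q == 0%N) = false); last by lia.
rewrite !bk_val ?val_pt /bk_fun; try lia.
by do ?case: ifP; lia.
Qed.

Lemma bk_reduced j k : 0 < k -> j + k <= n.+1 ->
  is_reduced_expr (flatten (b_factors n j k)) (bk n j k).
Proof.
by move=> k0 jk; rewrite /is_reduced_expr word_prod_flatten bk_length // !eqxx.
Qed.

Lemma bk_bigrassmannian (j k : nat) : 0 < k -> j + k <= n.+1 ->
  bigrassmannian j (bk n j k).
Proof.
move=> k0 jk; split=> i ij; rewrite /ascent.
  have := congr1 (@spoint_val n) (spermKV (bk n j k) (lo i)).
  have := congr1 (@spoint_val n) (spermKV (bk n j k) (hi i)).
  set x := (sperm_val _) (lo i); set y := (sperm_val _) (hi i).
  rewrite !bk_val // val_lo val_hi (negPf ij) /bk_fun.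
  have := spoint_range x; have := spoint_range y.
  by do ?case: ifP => ?; lia.
have hi_ := ltn_ord i.
rewrite !bk_val //; move: (val_lo i) (val_hi i).
move: (spoint_val (lo i)) (spoint_val (hi i)) => x y; rewrite /bk_fun.
by do ?case: ifP => ?; lia.
Qed.

Lemma card_negatives_bk (j k : nat) : 0 < k -> j + k <= n.+1 ->
  #|negatives j (bk n j k)| = k.
Proof.
move=> k0 jk; rewrite -[RHS](addKn j k) -card_interval; last by lia.
congr #|pred_of_set _|; apply/setP => z; rewrite !inE bk_val // /bk_fun.
by have := spoint_range z; do ?case: ifP; lia.
Qed.

Lemma card_negatives_le (j : nat) w : j <= n.+1 ->
  j + #|negatives j w| <= n.+1.
Proof. by move=> jn; have := negatives_longest w jn; lia. Qed.

(** * The chain of the b_k, and join-irreducibility *)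

(** Removing left descents other than 0 and right descents other than j keeps
the statistic, and it can only stop at the element of
[bigrassmannian_unique]. *)
Lemma bk_le (j : 'I_n.+1) w : 0 < #|negatives j w| ->
  (bk n j #|negatives j w| <= w)%O.
Proof.
have hj : j <= n.+1 by have := ltn_ord j; lia.
have [m] := ubnP (l w); elim: m w => // m IH w lw k0.
have up v : (v < w)%O -> #|negatives j v| = #|negatives j w| ->
    (bk n j #|negatives j w| <= w)%O.
  move=> vw e; rewrite -e; apply: le_trans (ltW vw); apply: IH; rewrite ?e //.
  move: (vw); rewrite lt_def => /andP[nvw /bruhat_le_length].
  by rewrite eq_sym (negPf nvw) /= => h; apply: leq_trans h _; lia.
have [i /andP[i0 wi]|L] :=
  pickP (fun i => (i != 0%N :> nat) && ~~ ascent w^-1 i).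
  by apply: up (bruhat_mull wi) _; rewrite negatives_mull.
have [i /andP[i0 wi]|R] := pickP (fun i => (i != j :> nat) && ~~ ascent w i).
  by apply: up (bruhat_mulr wi) _; rewrite negatives_mulr.
have gw : bigrassmannian j w.
  split=> i ii; first by have := L i; rewrite ii /= => /negbFE.
  by have := R i; rewrite ii /= => /negbFE.
have jk := card_negatives_le w hj.
rewrite {2}(bigrassmannian_unique gw (bk_bigrassmannian k0 jk)) //.
by rewrite card_negatives_bk.
Qed.

Lemma bk_left_descent (j k : nat) : 0 < k -> j + k <= n.+1 ->
  ~~ ascent (bk n j k)^-1 ord0.
Proof.
move=> k0 jk; rewrite ascentPn.
have := congr1 (@spoint_val n) (spermKV (bk n j k) (lo ord0)).
have := congr1 (@spoint_val n) (spermKV (bk n j k) (hi ord0)).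
set x := (sperm_val _) (lo ord0); set y := (sperm_val _) (hi ord0).
rewrite !bk_val // val_lo val_hi /= /bk_fun.
have := spoint_range x; have := spoint_range y.
by do ?case: ifP => ?; lia.
Qed.

Lemma bk_right_descent (j : 'I_n.+1) k : 0 < k -> j + k <= n.+1 ->
  ~~ ascent (bk n j k) j.
Proof.
move=> k0 jk; rewrite ascentPn !bk_val //; move: (val_lo j) (val_hi j).
move: (spoint_val (lo j)) (spoint_val (hi j)) => x y; rewrite /bk_fun.
by do ?case: ifP => ?; lia.
Qed.

(** Removing the letter 0 on the left turns the value -1 into 1, which lowers
the statistic from k + 1 to k; now [bk_le] applies. *)
Lemma bk_ltS (j : 'I_n.+1) k : 0 < k -> j + k.+1 <= n.+1 ->
  (bk n j k < bk n j k.+1)%O.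
Proof.
move=> k0 jk; pose b := bk n j k.+1; have k1 : 0 < k.+1 by [].
have bE z : spoint_val (b z) = bk_fun j k.+1 (spoint_val z) by apply: bk_val.
have d0 := bk_left_descent k1 jk.
have e : #|negatives j (s_ ord0 * b)| = k.
  rewrite -[RHS](addKn j k) -card_interval; last by lia.
  congr #|pred_of_set _|; apply/setP => z.
  rewrite !inE spermM simple_val /=; move: (spoint_range z) (bE z).
  move: (spoint_val (b z)) => y; rewrite /bk_fun.
  by do ?case: ifP => ?; lia.
apply: le_lt_trans (bruhat_mull d0).
by have := @bk_le j (s_ ord0 * b); rewrite e; apply.
Qed.

Lemma bk_lt (j : 'I_n.+1) k m : 0 < k -> k < m -> j + m <= n.+1 ->
  (bk n j k < bk n j m)%O.
Proof.
move=> k0; elim: m => // m IH; rewrite ltnS leq_eqVlt => /orP[/eqP<-|km] jm.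
  exact: bk_ltS.
by apply: lt_trans (IH km _) (bk_ltS _ _); lia.
Qed.

(** The element v below is the largest one whose statistic is less than k: the
anti-automorphism given by the longest element turns the lower bound [bk_le]
into this upper bound. *)
Lemma bk_join_irreducible (j : 'I_n.+1) k : 0 < k -> j + k <= n.+1 ->
  join_irreducible (bk n j k).
Proof.
move=> k0 jk; apply/existsPn => U; rewrite negb_and negbK.
have [bU|bU] := boolP (bk n j k \in U); first by rewrite orbT.
rewrite orbF; apply/negP => /andP[/forall_inP ub /forallP lub].
have hj : j <= n.+1 by lia.
pose v := longest * bk n j (n.+1 - j - k).+1.
have k'j : j + (n.+1 - j - k).+1 <= n.+1 by lia.
have fv : #|negatives j v| = k.-1.
  have := negatives_longest (bk n j (n.+1 - j - k).+1) hj.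
  by rewrite -/v card_negatives_bk //; lia.
have bv : (bk n j k <= v)%O.
  apply: (implyP (lub v)); apply/forall_inP => u uU.
  have ule := ub u uU.
  have := negatives_le j ule; rewrite card_negatives_bk // leq_eqVlt.
  case/orP => [/eqP fu|fu].
    suff ubk : u = bk n j k by rewrite -ubk uU in bU.
    by apply: le_anti; rewrite ule -fu bk_le ?fu.
  rewrite -[u]longestK; apply: longest_anti.
  have fu' := negatives_longest u hj.
  have p0 : 0 < #|negatives j (longest * u)| by lia.
  apply: le_trans (bk_le p0).
  have [->//|ne] := eqVneq #|negatives j (longest * u)| (n.+1 - j - k).+1.
  by apply/ltW/bk_lt; lia.
by have := negatives_le j bv; rewrite fv card_negatives_bk //; lia.
Qed.

(** An element with a left descent is not the identity, so its statistic is
positive and [bigrassmannian_unique] identifies it with some b_k. *)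
Lemma in_JI (j : 'I_n.+1) w :
  w \in JI ord0 j <-> exists2 k : nat, 1 <= k <= n.+1 - j & w = bk n j k.
Proof.
have hj : j <= n.+1 by have := ltn_ord j; lia.
split=> [|[k hk ->]].
  rewrite inE => /and3P[_ /eqP L /eqP R].
  have gw : bigrassmannian j w.
    split=> i ii; apply/negPn.
      by rewrite -left_descentE L inE; apply: contra ii => /eqP->.
    by rewrite -right_descentE R inE; apply: contra ii => /eqP->.
  have jk := card_negatives_le w hj.
  have k0 : 0 < #|negatives j w|.
    rewrite lt0n; apply/negP => /eqP k0.
    have g1 : bigrassmannian j 1.
      by split=> i _; rewrite ?invg1 /ascent !sperm1 lo_lt_hi.
    have : w = 1.
      apply: (bigrassmannian_unique gw g1); rewrite k0; apply/esym/eqP.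
      by rewrite cards_eq0; apply/eqP/setP => z; rewrite !inE sperm1; lia.
    move=> w1; have : ord0 \in left_descents w by rewrite L inE.
    by rewrite w1 inE length1.
  exists #|negatives j w|; first by lia.
  apply: (bigrassmannian_unique gw (bk_bigrassmannian k0 jk)).
  by rewrite card_negatives_bk.
have [k0 jk] : 0 < k /\ j + k <= n.+1 by lia.
have [gL gR] := bk_bigrassmannian k0 jk.
rewrite inE bk_join_irreducible //=; apply/andP; split; apply/eqP/setP => i.
  rewrite left_descentE inE; have [->|i0] := eqVneq i ord0.
    exact: bk_left_descent.
  by rewrite gL.
rewrite right_descentE inE; have [->|ij] := eqVneq i j.
  exact: bk_right_descent.
by rewrite gR.
Qed.
End Bigrassmannian.

Theorem proposition5p11 (n : nat) (n_ge1 : 1 <= n) (j : 'I_n.+1) :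
  (forall w : sperm n,
     w \in JI ord0 j <-> exists2 k : nat, 1 <= k <= n.+1 - j & w = bk n j k) /\
  (forall k : nat, 1 <= k <= n.+1 - j ->
     [/\ forall m : nat, 1 <= m <= j ->
           int_fun (bk n j k) (Posz m) = Posz (k + m),
         forall m : nat, 1 <= m <= k ->
           int_fun (bk n j k) (Posz (j + m)) = (- Posz (k + 1 - m))%R,
         forall m : nat, j + k < m <= n.+1 ->
           int_fun (bk n j k) (Posz m) = Posz m
       & is_reduced_expr (flatten (b_factors n j k)) (bk n j k)]) /\
  (forall k l : nat, 1 <= k -> k < l -> l <= n.+1 - j ->
     (bk n j k < bk n j l)%O).
Proof.
have hj := ltn_ord j.
split; first exact: in_JI.
split=> [k hk|k l k0 kl hl]; last by apply: bk_lt; lia.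
have [k0 jk] : 0 < k /\ j + k <= n.+1 by lia.
have value (m : nat) : 0 < m <= n.+1 ->
    int_fun (bk n j k) (Posz m) = bk_fun j k (Posz m).
  by move=> hm; rewrite int_fun_pt ?bk_val ?val_pt.
split=> [m hm|m hm|m hm|]; last exact: bk_reduced.
all: by rewrite value /bk_fun; do ?case: ifP; lia.
Qed.
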